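(* Let $0<\beta<\tfrac12$, let $N$ be a ground set with $|N|=n$, and let $\varepsilon\geq \frac{1}{n^{1/3-\beta}}$. For any (possibly randomized) algorithm in the value query model with query-complexity smaller than $2^{\Omega(n^{\beta/2})}$, there exist a cardinality bound $k$ and a function $F:2^N\to\mathbb{R}$ which $\varepsilon$-approximates a coverage function (i.e. there is a coverage function $f$ on $N$ with $(1-\varepsilon)f(S)\le F(S)\le(1+\varepsilon)f(S)$ for all $S\subseteq N$) such that, for the problem $\max_{S\subseteq N,\,|S|\leq k} F(S)$, the algorithm achieves an approximation ratio upper-bounded by $\frac{2}{n^{\beta/2}}$ with probability at least $1-\frac{1}{2^{\Omega(n^{\beta/2})}}$.
   Context: A coverage function: the elements of the ground set $N$ are subsets of a finite set $\mathcal{U}$ (the universe), and for $S=\{\mathcal{S}_1,\dots,\mathcal{S}_m\}\subseteq N$, $f(S)=\left|\bigcup_{i=1}^m\mathcal{S}_i\right|$. In the value query model the algorithm accesses $F$ only through an oracle returning $F(S)$ for a queried set $S$; query-complexity is the number of queries. A set $S$ with $|S|\le k$ achieves approximation ratio $\alpha$ if $F(S)\geq \alpha\max_{|T|\le k}F(T)$. *)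

(* Defs.v *)
From mathcomp Require Import all_boot all_order all_algebra.
From mathcomp Require Import all_classical all_reals all_analysis.

Set Implicit Arguments.
Unset Strict Implicit.
Unset Printing Implicit Defensive.

Import Order.TTheory GRing.Theory Num.Theory.
Local Open Scope classical_set_scope.
Local Open Scope ring_scope.

(* The ground set [N] is a set of subsets of the universe [U]: [C i] is the
   subset of [U] that [i : N] stands for, and distinct elements of [N] are
   distinct subsets. *)
Definition coverage (R : realType) (N : finType) (f : {set N} -> R) : Prop :=
  exists (U : finType) (C : N -> {set U}),
    injective C /\
    forall S : {set N}, f S = #|(\bigcup_(i in S) C i)%SET|%:R.

Definition approximates (R : realType) (N : finType) (eps : R)
    (F f : {set N} -> R) : Prop :=
  forall S : {set N}, (1 - eps) * f S <= F S <= (1 + eps) * f S.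

Definition approx_coverage (R : realType) (N : finType) (eps : R)
    (F : {set N} -> R) : Prop :=
  exists f : {set N} -> R, coverage f /\ approximates eps F f.

(* A deterministic adaptive algorithm in the value query model: the next step
   may depend in an arbitrary (not necessarily computable) way on the oracle
   answers received so far. *)
Inductive query_alg (R : realType) (N : finType) : Type :=
| Output of {set N}
| Query of {set N} & (R -> query_alg R N).

Fixpoint run (R : realType) (N : finType) (F : {set N} -> R)
    (a : query_alg R N) : {set N} :=
  match a with
  | Output X => X
  | Query X next => run F (next (F X))
  end.

Fixpoint num_queries (R : realType) (N : finType) (F : {set N} -> R)
    (a : query_alg R N) : nat :=
  match a with
  | Output _ => 0%N
  | Query X next => (num_queries F (next (F X))).+1%N
  end.

(* A randomized algorithm is given by a probability space [T] of coin outcomes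
   and, for each cardinality bound [k] (part of its input) and each outcome
   [w : T], a deterministic algorithm [A k w]. Its output on any oracle has to
   be a random variable with values in the finite type [{set N}]. *)
Definition random_output (R : realType) (N : finType)
    (d : measure_display) (T : measurableType d)
    (A : nat -> T -> query_alg R N) : Prop :=
  forall (k : nat) (F : {set N} -> R) (S : {set N}),
    measurable [set w : T | run F (A k w) = S].

(* Worst case over the coin outcomes and over all instances of the problem,
   i.e. all [k] and all oracles that [eps]-approximate a coverage function. *)
Definition query_complexity_lt (R : realType) (N : finType)
    (T : Type) (eps : R) (A : nat -> T -> query_alg R N) (q : R) : Prop :=
  forall (k : nat) (F : {set N} -> R) (w : T),
    approx_coverage eps F -> (num_queries F (A k w))%:R < q.

(* The default value [F set0] is one of the values maximized over. *)
Definition opt (R : realType) (N : finType) (F : {set N} -> R) (k : nat) : R :=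
  \big[Num.max/F finset.set0]_(S : {set N} | (#|S| <= k)%N) F S.

Definition achieves_ratio (R : realType) (N : finType) (F : {set N} -> R)
    (k : nat) (alpha : R) (S : {set N}) : Prop :=
  (#|S| <= k)%N /\ alpha * opt F k <= F S.

(* An infeasible [S] achieves no ratio; if the optimum were [0], every ratio
   would be achieved by every feasible [S] with [F S = 0], and no bound would
   hold. *)
Definition ratio_at_most (R : realType) (N : finType) (F : {set N} -> R)
    (k : nat) (rho : R) (S : {set N}) : Prop :=
  forall alpha : R, achieves_ratio F k alpha S -> alpha <= rho.

(* Main.v *)
(* A set H is hidden by putting each element of N in it with probability 1/r. The
   coverage function f(S) = |S cap H| + g(|S|), with g(s) = G (1 - (1 - 1/p)^s), is
   eps-close to its average |S|/r + g(|S|) unless S is exceptional, which has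
   probability at most 2 exp(-4t), t = n^(beta/2), for any fixed S: if |S| <= p then
   |S| <= eps g(|S|) and S is never exceptional, and if |S| >= p then g(|S|) >= G/2 and
   Chernoff's bound has an exponent of order -eps^2 G. The oracle F returns the average
   on all non-exceptional sets and f on the others. By a union bound over its queries,
   its output and N itself, the algorithm most likely runs as on the average, and then
   it gets a value of at most k/r + G, whereas k elements of H have a value of order k.
   Averaging over H fixes one hidden set. *)

Require Import Defs.
From mathcomp Require Import all_boot all_order all_algebra.
From mathcomp Require Import all_classical all_reals all_analysis.
From mathcomp Require Import measurable_realfun ring lra.

Set Implicit Arguments.
Unset Strict Implicit.
Unset Printing Implicit Defensive.

Import Order.TTheory GRing.Theory Num.Theory.
Local Open Scope classical_set_scope.
Local Open Scope ring_scope.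

(** * Hidden sets and the coverage function *)

(** For uniform [phi], each element lies in this set independently with probability 1/(r+1);
    probabilities thus become counts of functions. *)
Definition zeros (N : finType) (r : nat) (phi : {ffun N -> 'I_r.+1}) : {set N} :=
  [set i | phi i == ord0]%SET.

(* The weight [u = 0] counts the functions without zeros on [S], and [u = expR h]
   gives the moment generating function of [#|S :&: zeros phi|]. *)
Lemma sum_exp_card_zeros (R : realFieldType) (N : finType) (r : nat) (u : R)
    (S : {set N}) :
  \sum_(phi : {ffun N -> 'I_r.+1}) u ^+ #|S :&: zeros phi| =
  (r.+1 ^ #|N|)%:R * (1 - (1 - u) / r.+1%:R) ^+ #|S|.
Proof.
pose w i (j : 'I_r.+1) := if (i \in S) && (j == ord0) then u else 1.
transitivity (\sum_(phi : {ffun N -> 'I_r.+1}) \prod_i w i (phi i)).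
  apply: eq_bigr => phi _; rewrite -big_mkcond /=.
  rewrite (eq_bigl [in S :&: zeros phi]); last by move=> i; rewrite !inE.
  by rewrite prodr_const.
rewrite -bigA_distr_bigA /=.
have r0 : r.+1%:R != 0 :> R by rewrite pnatr_eq0.
have -> : \prod_i \sum_j w i j =
    \prod_i (r.+1%:R * if i \in S then 1 - (1 - u) / r.+1%:R else 1).
  apply: eq_bigr => i _; rewrite big_ord_recl /w eqxx andbT /=.
  rewrite (eq_bigr (fun=> 1)) => [|j _]; last by rewrite andbF.
  rewrite sumr_const card_ord; case: ifP => _; last by rewrite mulr1 -natr1 addrC.
  by rewrite mulrBr mulr1 mulrCA mulfV// mulr1 -natr1; ring.
by rewrite big_split /= prodr_const -big_mkcond/= prodr_const natrX.
Qed.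

(* A universe of all functions from [N] to ['I_p.+1], where [i] covers the [v] with
   [v i = 0], has integer coverage counts; the factor [p.+1 ^ #|N|] is its size, and
   each element of [H] covers as many private points. *)
Definition saturating (R : realType) (p G s : nat) : R :=
  G%:R * (1 - (1 - 1 / p.+1%:R) ^+ s).

Definition hidden_coverage (R : realType) (N : finType) (p G : nat)
    (H S : {set N}) : R :=
  (p.+1 ^ #|N|)%:R * (#|S :&: H|%:R + saturating R p G #|S|).

Lemma card_disjoint_sum (T1 T2 : finType) (A : {set T1}) (B : {set T2}) :
  #|(inl @: A :|: inr @: B)%SET : {set (T1 + T2)%type}| = (#|A| + #|B|)%N.
Proof.
rewrite cardsU disjoint_setI0; first by rewrite cards0 subn0 !card_imset// => ? ? [].
apply/pred0P => u /=; apply/negP => /andP[/imsetP[x _ ->]].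
by case/imsetP.
Qed.

(** The first summand of the universe yields the hits. The [G] copies of the function space yield
    the saturating part: weight 0 in [sum_exp_card_zeros] counts the functions left uncovered by
    [S]. *)
Lemma coverage_hidden (R : realType) (N : finType) (p G : nat) (H : {set N}) :
  (0 < p)%N -> (0 < G)%N -> coverage (@hidden_coverage R N p G H).
Proof.
move=> p0 G0.
pose V := {ffun N -> 'I_p.+1}.
pose C (i : N) : {set ('I_(p.+1 ^ #|N|) * N + 'I_G * V)%type} :=
  [set u | match u with
           | inl v => (v.2 == i) && (i \in H)
           | inr v => (v.2 : V) i == ord0
           end]%SET.
exists ('I_(p.+1 ^ #|N|) * N + 'I_G * V)%type, C; split.
  move=> i j /setP eC; apply/eqP; apply/negPn/negP => ij.
  (* This function vanishes only at [i], as [p > 0] separates [ord_max] from [ord0]; [G > 0]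
     provides a copy containing it. *)
  have := eC (inr (Ordinal G0, [ffun l => if l == i then ord0 else ord_max])).
  rewrite !inE /= !ffunE [j == i]eq_sym (negPf ij) !eqxx => /esym/eqP/(congr1 val) /=.
  by move=> e; rewrite e in p0.
move=> S.
pose Z := [set phi : V | S :&: zeros phi != finset.set0]%SET.
have -> : (\bigcup_(i in S) C i =
    (inl @: finset.setX [set: 'I_(p.+1 ^ #|N|)] (S :&: H)) :|:
    (inr @: finset.setX [set: 'I_G] Z))%SET.
  apply/setP => u; apply/bigcupP/setUP.
    case=> i iS; rewrite inE; case: u => [[a j] /= /andP[/eqP -> iH]|[a phi] /= phi0].
      by left; apply: imset_f; rewrite !inE iS iH.
    right; apply: imset_f; rewrite !inE /=; apply/set0Pn; exists i.
    by rewrite !inE iS.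
  case=> /imsetP[[a v]]; rewrite !inE /= => h ->.
    by case/andP: h => vS vH; exists v => //; rewrite inE /= eqxx.
  by case/set0Pn: h => i /setIP[iS]; rewrite inE => i0; exists i => //; rewrite inE.
rewrite card_disjoint_sum.
rewrite !cardsX !cardsT !card_ord natrD !natrM.
rewrite /hidden_coverage /saturating mulrDr; congr (_ + _).
rewrite mulrCA; congr (_ * _).
have := sum_exp_card_zeros p (0 : R) S; rewrite subr0 => e.
rewrite mulrBr mulr1 -e.
have -> : (p.+1 ^ #|N|)%:R = \sum_(phi : V) 1 :> R.
  by rewrite sumr_const card_ffun card_ord.
rewrite -sumrB -sum1_card natr_sum [RHS]big_mkcond; apply: eq_bigr => phi _.
by rewrite inE expr0n cards_eq0; case: eqP => _ /=; rewrite ?subrr ?subr0.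
Qed.

(** * Non-adaptive list of queries *)

(** The cut at [m] keeps the list short on any oracle: the query bound is assumed only for oracles
    that approximate a coverage function, which is not claimed of the average. *)
Fixpoint first_sets (R : realType) (N : finType) (F : {set N} -> R) (m : nat)
    (a : query_alg R N) : seq {set N} :=
  match m, a with
  | 0%N, _ => [::]
  | _, Output X => [:: X]
  | m'.+1, Query X next => X :: first_sets F m' (next (F X))
  end.

Lemma size_first_sets (R : realType) (N : finType) (F : {set N} -> R) m a :
  (size (first_sets F m a) <= m)%N.
Proof. by elim: m a => [|m IH] [X|X next] //=; rewrite ltnS. Qed.

(* [F0] is the oracle whose answers determine the sets to be checked, whereas only
   the number of queries made to [F] is bounded. *)
Lemma run_first_sets (R : realType) (N : finType) (F0 F : {set N} -> R) m a :
  (num_queries F a < m)%N ->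
  (forall S, S \in first_sets F0 m a -> F S = F0 S) ->
  run F a \in first_sets F0 m a.
Proof.
elim: m a => [|m IH] [X|X next] //=; first by rewrite inE.
rewrite ltnS => lt_m agree.
have eX : F X = F0 X by apply: agree; rewrite inE eqxx.
rewrite eX in lt_m *; rewrite inE IH ?orbT// => S hS.
by apply: agree; rewrite inE hS orbT.
Qed.

(** * Averaging over the coins *)

(** The probabilities of the complements sum to the expected number of failing [i], at most
    [b * #|I|]. Were each above [b], the sum would be larger; [i0] makes [I] nonempty and this
    strict. *)
Lemma exists_likely_event (R : realType) (d : measure_display)
    (T : measurableType d) (P : probability T R) (I : finType)
    (E : I -> set T) (b : R) (i0 : I) :
  (forall i, measurable (E i)) ->
  (forall w, (#|[set i | ~~ `[< E i w >]]%SET|%:R <= b * #|I|%:R)) ->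
  exists i, ((1 - b)%:E <= P (E i))%E.
Proof.
move=> mE hb; apply: contrapT => /forallNP hn.
have hs : (\sum_(i : I) P (~` E i) <= (b * #|I|%:R)%:E)%E.
  have -> : (\sum_(i : I) P (~` E i) = \int[P]_w \sum_(i : I) (\1_(~` E i) w)%:E)%E.
    rewrite ge0_integral_sum; last 3 first.
    - exact: measurableT.
    - by move=> i; apply/measurable_EFinP; apply: measurable_indic; apply: measurableC.
    - by move=> i w _; rewrite lee_fin.
    apply: eq_bigr => i _; rewrite integral_indic ?setIT//; exact: measurableC.
  apply: (@le_trans _ _ (\int[P]_w (b * #|I|%:R)%:E)%E); last first.
    by rewrite integral_cst// [X in (_ * X)%E]probability_setT mule1.
  apply: ge0_le_integral => //.
  - by move=> w _; apply: sume_ge0 => i _; rewrite lee_fin.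
  - apply: emeasurable_sum => i; apply/measurable_EFinP; apply: measurable_indic.
    exact: measurableC.
  - move=> w _; rewrite sumEFin lee_fin; apply: le_trans (hb w).
    rewrite -sum1_card natr_sum [leRHS]big_mkcond /=; apply: ler_sum => i _.
    rewrite inE indicE; case: asboolP => /= h; last by rewrite lern1 leq_b1.
    by rewrite memNset//= => /(_ h).
move: hs; rewrite leNgt => /negP; apply.
have PC i : P (~` E i) = (fine (P (~` E i)))%:E.
  by rewrite fineK// fin_num_measure//; exact: measurableC.
rewrite (eq_bigr _ (fun i _ => PC i)) sumEFin lte_fin mulr_natr -sumr_const.
apply: ltr_sum => [|i _]; first by apply/hasP; exists i0; rewrite ?mem_index_enum.
have /negP := hn i; rewrite -ltNge -lte_fin -PC probability_setC//.
have := fin_num_measure P _ (mE i).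
move=> /fineK <-; set r := fine _; rewrite lte_fin => h.
by rewrite (_ : 1 - r%:E = (1 - r)%:E)%E// lte_fin; lra.
Qed.

(** * Chernoff bounds for the hits *)

(** From 1 - h <= e^(-h) follows e^h <= 1/(1 - h), and (1 - h)(1 + h + 2h^2) = 1 + h^2(1 - 2h) >=
    1. *)
Lemma expR_le_quadratic (R : realType) (h : R) :
  `|h| <= 1 / 2 -> expR h <= 1 + h + 2 * h ^+ 2.
Proof.
rewrite ler_norml => /andP[h1 h2].
have := expR_ge1Dx (- h); rewrite expRN => hN.
have h0 : 0 < 1 - h by lra.
apply: (@le_trans _ _ (1 - h)^-1).
  by rewrite -[expR h]invrK lef_pV2// posrE ?invr_gt0 ?expR_gt0.
rewrite -[leLHS]div1r ler_pdivrMr//.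
have := sqr_ge0 h; nra.
Qed.

Definition hits (R : realType) (N : finType) (r : nat) (phi : {ffun N -> 'I_r.+1})
  (S : {set N}) : R := #|S :&: zeros phi|%:R.

Lemma mgf_hits (R : realType) (N : finType) (r : nat) (h : R) (S : {set N}) :
  `|h| <= 1 / 2 ->
  \sum_(phi : {ffun N -> 'I_r.+1}) expR (h * hits R phi S) <=
  (r.+1 ^ #|N|)%:R * expR ((h + 2 * h ^+ 2) * (#|S|%:R / r.+1%:R)).
Proof.
move=> h12; rewrite (eq_bigr (fun phi => expR h ^+ #|S :&: zeros phi|)); last first.
  by move=> phi _; rewrite /hits expRM_natr.
rewrite sum_exp_card_zeros ler_wpM2l//.
have r0 : 0 < r.+1%:R :> R by rewrite ltr0n.
have r1 : 1 <= r.+1%:R :> R by rewrite ler1n.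
have u0 := expR_gt0 h.
rewrite [in leRHS]mulrCA expRM_natl; apply: lerXn2r; rewrite ?nnegrE ?expR_ge0//.
  by rewrite subr_ge0 ler_pdivrMr//; lra.
apply: le_trans (_ : 1 + (expR h - 1) / r.+1%:R <= _).
  by rewrite -mulNr opprB.
apply: le_trans (expR_ge1Dx _) _; rewrite ler_expR ler_wpM2r ?invr_ge0 ?(ltW r0)//.
by have := expR_le_quadratic h12; lra.
Qed.

(** Markov's inequality for the exponential moment; the sign of [h] selects the tail. *)
Lemma chernoff_hits (R : realType) (N : finType) (r : nat) (h a : R) (S : {set N}) :
  `|h| <= 1 / 2 ->
  #|[set phi : {ffun N -> 'I_r.+1} |
      a <= h * (hits R phi S - #|S|%:R / r.+1%:R)]%SET|%:R <=
  (r.+1 ^ #|N|)%:R * expR (2 * h ^+ 2 * (#|S|%:R / r.+1%:R) - a).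
Proof.
move=> h12; set x : R := #|S|%:R / _.
apply: (@le_trans _ _ (\sum_(phi : {ffun N -> 'I_r.+1})
    expR (h * hits R phi S) * expR (- h * x - a))).
  rewrite -sum1_card natr_sum [leLHS]big_mkcond; apply: ler_sum => phi _.
  rewrite inE -expRD.
  case: ifP => [le_a|_]; last exact: expR_ge0.
  by apply: le_trans (expR_ge1Dx _); lra.
rewrite -mulr_suml; apply: le_trans (ler_wpM2r (expR_ge0 _) (mgf_hits r S h12)) _.
by rewrite -(mulrA _ (expR _)) -expRD ler_wpM2l// ler_expR -/x; lra.
Qed.

(* [x] is the expected and [y] the actual number of hits, [g] the part of the value
   that does not depend on the hidden set. *)
Definition disagree (R : realType) (e x y g : R) : bool :=
  ~~ ((1 - e) * (y + g) <= x + g <= (1 + e) * (y + g)).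

(** Either failure forces |y - x| >= e(x + g)/2, a deviation relative to the mean; the factor e/8 is
    the later Chernoff parameter. *)
Lemma disagree_deviation (R : realType) (e x y g : R) :
  0 < e -> e <= 1 / 2 -> 0 <= x -> 0 <= y -> 0 <= g -> disagree e x y g ->
  (e ^+ 2 * (x + g) / 16 <= e / 8 * (y - x)) ||
  (e ^+ 2 * (x + g) / 16 <= - (e / 8) * (y - x)).
Proof.
move=> e0 e12 x0 y0 g0; rewrite /disagree negb_and -!ltNge.
have e1 : 0 <= e by exact: ltW.
have eyg : 0 <= e * (y + g) by rewrite mulr_ge0 ?addr_ge0.
move=> /orP[h|h]; apply/orP; [left|right].
  have xy : 0 <= y - x by lra.
  have exy : 0 <= e * (y - x) by rewrite mulr_ge0.
  have : 0 <= e * (y - x - e * (x + g)) by rewrite mulr_ge0//; lra.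
  have : 0 <= e * (e * (x + g)) by rewrite !mulr_ge0 ?addr_ge0.
  by lra.
have h1 : 0 <= (1 - e) * (e * (y + g)) by rewrite mulr_ge0//; lra.
(* Since (2 - e)(1 + e) >= 2, this gives 2(x - y) >= e(x + g). *)
have h2 : 0 <= (2 - e) * (x + g - (1 + e) * (y + g)) by rewrite mulr_ge0//; lra.
have h3 : 0 <= 2 * (x - y) - e * (x + g) by lra.
have : 0 <= e * (2 * (x - y) - e * (x + g)) by rewrite mulr_ge0.
by lra.
Qed.

(** Both tails, h = e/8 and h = -e/8: the exponent 2h^2 x - e^2(x + g)/16 equals -e^2(x + 2g)/32. *)
Lemma card_disagree (R : realType) (N : finType) (r : nat) (e g : R) (S : {set N}) :
  0 < e -> e <= 1 / 2 -> 0 <= g ->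
  #|[set phi : {ffun N -> 'I_r.+1} |
      disagree e (#|S|%:R / r.+1%:R) (hits R phi S) g]%SET|%:R <=
  2 * (r.+1 ^ #|N|)%:R * expR (- (e ^+ 2 * (#|S|%:R / r.+1%:R + g) / 32)).
Proof.
move=> e0 e12 g0; set x : R := #|S|%:R / r.+1%:R.
have x0 : 0 <= x by rewrite divr_ge0.
pose B h := [set phi : {ffun N -> 'I_r.+1} |
    e ^+ 2 * (x + g) / 16 <= h * (hits R phi S - x)]%SET.
have sub : ([set phi : {ffun N -> 'I_r.+1} | disagree e x (hits R phi S) g] \subset
    B (e / 8) :|: B (- (e / 8)))%SET.
  apply/fintype.subsetP => phi; rewrite !inE.
  by apply: disagree_deviation.
have e8 : `|e / 8| <= 1 / 2 by rewrite ger0_norm; lra.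
have bnd h : h ^+ 2 = (e / 8) ^+ 2 -> `|h| <= 1 / 2 -> #|B h|%:R <=
    (r.+1 ^ #|N|)%:R * expR (- (e ^+ 2 * (x + g) / 32)).
  move=> hh h12; apply: le_trans (chernoff_hits r _ S h12) _.
  rewrite ler_wpM2l// ler_expR hh -/x.
  have : 0 <= e ^+ 2 * g by rewrite mulr_ge0// sqr_ge0.
  by rewrite expr_div_n; lra.
apply: (@le_trans _ _ (#|B (e / 8)| + #|B (- (e / 8))|)%:R).
  by rewrite ler_nat (leq_trans (subset_leq_card sub))// leq_card_setU.
by rewrite natrD -mulrA mulr_natl lerD ?bnd ?sqrrN ?normrN.
Qed.

(** * Rarity of disagreement on a fixed set *)

(** With z = s/(p+1), this amounts to [saturating] >= G z/(1 + z): at least G/2 for z >= 1, and at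
    least G z/2 for z <= 1. *)
Lemma exp_1BV_le (R : realType) (p s : nat) :
  (1 - 1 / p.+1%:R) ^+ s * (1 + s%:R / p.+1%:R) <= 1 :> R.
Proof.
have p1 : 1 <= p.+1%:R :> R by rewrite ler1n.
apply: le_trans (_ : expR (- (1 / p.+1%:R)) ^+ s * expR (s%:R / p.+1%:R) <= _).
  apply: ler_pM.
  - by rewrite exprn_ge0// subr_ge0 ler_pdivrMr; lra.
  - by rewrite addr_ge0.
  - apply: lerXn2r; rewrite ?nnegrE ?expR_ge0//; last exact: expR_ge1Dx.
    by rewrite subr_ge0 ler_pdivrMr; lra.
  - exact: expR_ge1Dx.
by rewrite -expRM_natl -expRD mulrN mulrA mulr1 addNr expR0.
Qed.

Lemma exp_1BV_itv (R : realType) (p s : nat) :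
  0 <= (1 - 1 / p.+1%:R : R) ^+ s <= 1.
Proof.
have p1 : 1 <= p.+1%:R :> R by rewrite ler1n.
have p2 : 0 <= 1 / p.+1%:R :> R by [].
have p3 : 1 / p.+1%:R <= 1 :> R by rewrite ler_pdivrMr; lra.
by rewrite exprn_ge0 ?exprn_ile1 ?subr_ge0 ?gerBl.
Qed.

Lemma saturating_itv (R : realType) (p G s : nat) :
  0 <= saturating R p G s <= G%:R.
Proof.
have /andP[q0 q1] := exp_1BV_itv R p s.
by rewrite mulr_ge0//= ?subr_ge0// ler_piMr//; lra.
Qed.

Lemma rare_disagreement (R : realType) (N : finType) (r p G : nat) (e tau : R)
    (S : {set N}) :
  0 < e -> e <= 1 / 2 -> 2 * p.+1%:R <= e * G%:R -> 64 * tau <= e ^+ 2 * G%:R ->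
  #|[set phi : {ffun N -> 'I_r.+1} | disagree e (#|S|%:R / r.+1%:R)
       (hits R phi S) (saturating R p G #|S|)]%SET|%:R <=
  2 * (r.+1 ^ #|N|)%:R * expR (- tau).
Proof.
move=> e0 e12 hp htau.
have /andP[g0 _] := saturating_itv R p G #|S|.
have P0 : 0 < p.+1%:R :> R by rewrite ltr0n.
have G0 : 0 <= G%:R :> R by [].
have := exp_1BV_le R p #|S|; have := exp_1BV_itv R p #|S|.
rewrite /saturating in g0 *; set q : R := _ ^+ #|S| in g0 *.
move=> /andP[q0 _].
have zE : #|S|%:R = #|S|%:R / p.+1%:R * p.+1%:R :> R by rewrite divfK// gt_eqF.
have z0 : 0 <= #|S|%:R / p.+1%:R :> R by rewrite divr_ge0.
move: (#|S|%:R / p.+1%:R) z0 zE => z z0 zE hq.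
move: p.+1%:R P0 hp zE => P P0 hp zE; clearbody q.
have x0 : 0 <= #|S|%:R / r.+1%:R :> R by rewrite divr_ge0.
have xs : #|S|%:R / r.+1%:R <= #|S|%:R :> R.
  by rewrite ler_pdivrMr ?ltr0n// ler_peMr// ler1n.
have [z1|/ltW z1] := leP z 1; last first.
  apply: le_trans (card_disagree r S e0 e12 g0) _.
  rewrite ler_wpM2l ?mulr_ge0// ler_expR lerN2.
  have qz : 0 <= q * (z - 1) by rewrite mulr_ge0// subr_ge0.
  have : 0 <= e ^+ 2 * (#|S|%:R / r.+1%:R) by rewrite mulr_ge0// sqr_ge0.
  have : 0 <= e ^+ 2 * G%:R * (1 / 2 - q) by rewrite !mulr_ge0 ?sqr_ge0//; lra.
  by move: (#|S|%:R / r.+1%:R) => x; lra.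
rewrite eq_card0 => [|phi]; last first.
  rewrite !inE; apply/negbTE; rewrite negbK.
  have y0 : 0 <= hits R phi S by [].
  have ys : hits R phi S <= #|S|%:R by rewrite ler_nat subset_leq_card// finset.subsetIl.
  have sg : #|S|%:R <= e * (G%:R * (1 - q)).
    have zz : 0 <= z * (1 - z) by rewrite mulr_ge0// subr_ge0.
    have hz : z <= 2 * (1 - q).
      (* After multiplication by 1 + z, the bound q(1 + z) <= 1 leaves z(1 - z) >= 0. *)
      rewrite -subr_ge0 -(pmulr_rge0 _ (_ : 0 < 1 + z)); last by rewrite ltr_pwDl.
      by lra.
    have : P * z <= e * G%:R / 2 * (2 * (1 - q)) by apply: ler_pM => //; lra.
    by rewrite mulrC -zE; lra.
  have ey : 0 <= e * hits R phi S by rewrite mulr_ge0// ltW.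
  move: (#|S|%:R / r.+1%:R) x0 xs => x x0 xs.
  by apply/andP; split; lra.
by rewrite !mulr_ge0// expR_ge0.
Qed.

(** * The masked oracle and its optimum *)

Definition average_value (R : realType) (N : finType) (r p G : nat) (S : {set N}) : R :=
  (p.+1 ^ #|N|)%:R * (#|S|%:R / r.+1%:R + saturating R p G #|S|).

Definition masked_value (R : realType) (N : finType) (r p G : nat) (e : R)
    (phi : {ffun N -> 'I_r.+1}) (S : {set N}) : R :=
  if disagree e (#|S|%:R / r.+1%:R) (hits R phi S) (saturating R p G #|S|)
  then hidden_coverage R p G (zeros phi) S else average_value R r p G S.

Lemma hidden_coverage_ge0 (R : realType) (N : finType) (p G : nat) (H S : {set N}) :
  0 <= hidden_coverage R p G H S.
Proof.
have /andP[g0 _] := saturating_itv R p G #|S|.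
by rewrite mulr_ge0// addr_ge0.
Qed.

(** Up to the common factor [p.+1 ^ #|N|], [disagree] is exactly the failure of the approximation,
    and there the true value is returned. *)
Lemma approximates_masked (R : realType) (N : finType) (r p G : nat) (e eps : R)
    (phi : {ffun N -> 'I_r.+1}) :
  0 <= e -> e <= eps ->
  approximates eps (masked_value p G e phi) (hidden_coverage R p G (zeros phi)).
Proof.
move=> e0 e_eps S; have f0 := hidden_coverage_ge0 R p G (zeros phi) S.
have eps_f : e * hidden_coverage R p G (zeros phi) S <=
    eps * hidden_coverage R p G (zeros phi) S by rewrite ler_wpM2r.
have ef : 0 <= e * hidden_coverage R p G (zeros phi) S by rewrite mulr_ge0.
rewrite /masked_value; case: ifPn => [_|]; first by apply/andP; split; lra.
rewrite negbK => /andP[h1 h2].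
have W0 : 0 <= (p.+1 ^ #|N|)%:R :> R by [].
have := ler_wpM2l W0 h1; have := ler_wpM2l W0 h2.
move: eps_f ef; rewrite /average_value /hidden_coverage -/(hits R phi S).
rewrite -/(saturating R p G #|S|); set W : R := (_ ^ _)%:R.
set g := saturating _ _ _ _; set y := hits _ _ _; set x : R := _ / _.
rewrite ![W * (_ * _)]mulrCA => *; apply/andP; split; lra.
Qed.

Lemma approx_coverage_masked (R : realType) (N : finType) (r p G : nat) (e eps : R)
    (phi : {ffun N -> 'I_r.+1}) :
  (0 < p)%N -> (0 < G)%N -> 0 <= e -> e <= eps ->
  approx_coverage eps (masked_value p G e phi).
Proof.
move=> p0 G0 e0 e_eps; exists (hidden_coverage R p G (zeros phi)).
by split; [exact: coverage_hidden|exact: approximates_masked].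
Qed.

Lemma le_opt (R : realType) (N : finType) (F : {set N} -> R) (k : nat) (S : {set N}) :
  (#|S| <= k)%N -> F S <= opt F k.
Proof. by move=> Sk; rewrite /opt; apply: le_bigmax_cond. Qed.

(** Up to the common factor, agreement on [N] provides [k] hidden elements, worth at least k/2
    together, and agreement on [S] caps its value at k/t. *)
Lemma ratio_masked (R : realType) (N : finType) (r p G k : nat) (e t : R)
    (phi : {ffun N -> 'I_r.+1}) (S : {set N}) :
  0 <= e -> e <= 1 / 2 -> 1 <= t -> (0 < k)%N ->
  2 * t <= r.+1%:R -> 2 * t * G%:R <= k%:R -> 2 * k%:R <= #|N|%:R / r.+1%:R :> R ->
  (forall X, X \in [:: [set: N]%SET; S] ->
    ~~ disagree e (#|X|%:R / r.+1%:R) (hits R phi X) (saturating R p G #|X|)) ->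
  ratio_at_most (masked_value p G e phi) k (2 / t) S.
Proof.
move=> e0 e12 t1 k0 tr tG kN agree alpha [Sk].
have t0 : 0 < t by lra.
have r0 : 0 < r.+1%:R :> R by rewrite ltr0n.
have k0R : 0 < k%:R :> R by rewrite ltr0n.
have GG : 0 <= G%:R :> R by [].
have W0 : 0 < (p.+1 ^ #|N|)%:R :> R by rewrite ltr0n expn_gt0.
have kz : (k <= #|zeros phi|)%N.
  (* Here 2k + g <= 3/2 (|H| + g) and g <= G <= k/2, so |H| >= k. *)
  have /= := agree [set: N]%SET; rewrite inE eqxx => /(_ isT).
  rewrite negbK cardsT /hits finset.setTI => /andP[_].
  have /andP[g0 g1] := saturating_itv R p G #|N|.
  move: (saturating R p G #|N|) g0 g1 => g g0 g1.
  move: (#|N|%:R / r.+1%:R) kN => x kN h.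
  have h1 : 0 <= (t - 1) * G%:R by rewrite mulr_ge0//; lra.
  have h2 : 0 <= (1 / 2 - e) * g by rewrite mulr_ge0//; lra.
  have h3 : 0 <= (1 / 2 - e) * #|zeros phi|%:R by rewrite mulr_ge0//; lra.
  by rewrite -(ler_nat R); lra.
have [H [uH sH subH]] := card_geqP kz.
pose T := [set i in H]%SET.
have Tk : #|T| = k by rewrite cardsE -sH; apply/card_uniqP.
have TZ : (T :&: zeros phi = T)%SET.
  by apply/finset.setIidPl/fintype.subsetP => i; rewrite inE; apply: subH.
set W : R := (p.+1 ^ #|N|)%:R in W0.
have opt_ge : W * k%:R / 2 <= opt (masked_value p G e phi) k.
  apply: le_trans (le_opt _ (_ : (#|T| <= k)%N)); last by rewrite Tk.
  have /andP[+ _] := approximates_masked p G phi e0 (lexx e) T.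
  apply: le_trans; rewrite /hidden_coverage TZ Tk -/W -/(saturating R p G k).
  have /andP[g0 _] := saturating_itv R p G k.
  rewrite [leRHS]mulrCA -mulrA ler_pM2l//.
  have : 0 <= (1 - e) * saturating R p G k by rewrite mulr_ge0//; lra.
  have : 0 <= (1 / 2 - e) * k%:R by rewrite mulr_ge0//; lra.
  by lra.
have FS : masked_value p G e phi S <= W * k%:R / t.
  rewrite /masked_value (negPf (agree _ _)) ?inE ?eqxx ?orbT// /average_value -/W.
  rewrite -mulrA ler_pM2l//.
  have /andP[_ g1] := saturating_itv R p G #|S|.
  have h1 : #|S|%:R / r.+1%:R <= k%:R / (2 * t).
    by apply: ler_pM => //; rewrite ?invr_ge0 ?ler_nat// lef_pV2// posrE; lra.
  have h2 : G%:R <= k%:R / (2 * t) by rewrite ler_pdivlMr; lra.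
  have -> : k%:R / t = k%:R / (2 * t) + k%:R / (2 * t) :> R by field; lra.
  by rewrite lerD// (le_trans g1).
move=> /le_trans /(_ FS).
set o := opt _ _ in opt_ge *.
have o0 : 0 < o by apply: lt_le_trans opt_ge; rewrite divr_gt0// mulr_gt0.
move=> h; rewrite -(ler_pM2r o0); apply: le_trans h _.
rewrite [leRHS]mulrAC ler_pM2r ?invr_gt0//; lra.
Qed.

(** * Union bound over the queries *)

Lemma measurable_output (R : realType) (N : finType) (d : measure_display)
    (T : measurableType d) (A : nat -> T -> query_alg R N) (k : nat)
    (F : {set N} -> R) (B : {set N} -> Prop) :
  random_output A -> measurable [set w : T | B (run F (A k w))].
Proof.
move=> hA.
rewrite (_ : mkset _ = \big[setU/set0]_(S <- enum {set N} | `[< B S >])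
    [set w : T | run F (A k w) = S]).
  by apply: bigsetU_measurable => S _; exact: hA.
apply/seteqP; split => w /=; rewrite -bigcup_seq_cond /=.
  by move=> Bw; exists (run F (A k w)) => //=; rewrite mem_enum /=; apply/asboolP.
by case=> S /= /andP[_ /asboolP BS] ->.
Qed.

Lemma hidden_set_hard (R : realType) (N : finType) (r p G k : nat) (e eps t tau q : R)
    (d : measure_display) (T : measurableType d) (P : probability T R)
    (A : nat -> T -> query_alg R N) :
  0 < e -> e <= 1 / 2 -> e <= eps -> 1 <= t -> (0 < k)%N -> (0 < p)%N -> (0 < G)%N ->
  2 * t <= r.+1%:R -> 2 * t * G%:R <= k%:R -> 2 * k%:R <= #|N|%:R / r.+1%:R :> R ->
  2 * p.+1%:R <= e * G%:R -> 64 * tau <= e ^+ 2 * G%:R ->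
  random_output A -> query_complexity_lt eps A q -> 0 <= q ->
  exists F : {set N} -> R, approx_coverage eps F /\
    ((1 - (q + 2) * (2 * expR (- tau)))%:E <=
      P [set w : T | ratio_at_most F k (2 / t) (run F (A k w))])%E.
Proof.
move=> e0 e12 e_eps t1 k0 p0 G0 tr tG kN hp htau hA hq q0.
have e0' : 0 <= e by exact: ltW.
pose F (phi : {ffun N -> 'I_r.+1}) := masked_value p G e phi.
have aF phi : approx_coverage eps (F phi) by exact: approx_coverage_masked.
have [phi hphi] : exists phi, ((1 - (q + 2) * (2 * expR (- tau)))%:E <=
    P [set w : T | ratio_at_most (F phi) k (2 / t) (run (F phi) (A k w))])%E.
  apply: (@exists_likely_event _ _ _ P _ (fun phi => [set w : T |
    ratio_at_most (F phi) k (2 / t) (run (F phi) (A k w))]) _ [ffun=> ord0]).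
    by move=> phi; apply: measurable_output.
  move=> w.
  (* The list depends on the coins but not on [phi], which permits a union bound over its at most q
     + 2 sets. *)
  pose L := [set: N]%SET :: first_sets (average_value R r p G) (Num.truncn q).+1 (A k w).
  have sub : ([set phi | ~~ `[< ratio_at_most (F phi) k (2 / t) (run (F phi) (A k w)) >]]
      \subset \bigcup_(X <- L) [set phi : {ffun N -> 'I_r.+1} |
        disagree e (#|X|%:R / r.+1%:R) (hits R phi X) (saturating R p G #|X|)])%SET.
    apply/fintype.subsetP => phi; rewrite inE; apply: contraR => hL.
    have agree X : X \in L ->
        ~~ disagree e (#|X|%:R / r.+1%:R) (hits R phi X) (saturating R p G #|X|).
      move=> XL; apply: contra hL => dX; rewrite finset.bigcup_seq.
      by apply/finset.bigcupP; exists X; rewrite ?inE.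
    apply/asboolP; apply: (@ratio_masked R N r p G k e t phi) => // X.
    rewrite !inE => /orP[/eqP ->|/eqP ->]; apply: (agree _); first by rewrite inE eqxx.
    (* Agreement on [L] makes the masked oracle answer like the average along the run, so the actual
       output is on the list. *)
    rewrite inE; apply/orP; right; apply: run_first_sets.
      by rewrite ltnS truncn_ge_nat// ltW// hq.
    move=> X' X'L; rewrite /F /masked_value (negPf (agree _ _))//.
    by rewrite inE X'L orbT.
  apply: le_trans (_ : (\sum_(X <- L) #|[set phi : {ffun N -> 'I_r.+1} |
        disagree e (#|X|%:R / r.+1%:R) (hits R phi X) (saturating R p G #|X|)]%SET|)%:R <= _).
    rewrite ler_nat; apply: leq_trans (subset_leq_card sub) _.
    elim: L {sub} => [|X L IH]; first by rewrite !big_nil cards0.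
    by rewrite !big_cons (leq_trans (leq_card_setU _ _))// leq_add2l.
  rewrite natr_sum; apply: (@le_trans _ _ (\sum_(X <- L)
      2 * (r.+1 ^ #|N|)%:R * expR (- tau))).
    by apply: ler_sum => X _; exact: rare_disagreement.
  rewrite big_const_seq count_predT iter_addr_0 -[leLHS]mulr_natl card_ffun card_ord.
  rewrite [leRHS](_ : _ = (q + 2) * (2 * (r.+1 ^ #|N|)%:R * expR (- tau))); last by ring.
  apply: ler_wpM2r; first by rewrite !mulr_ge0 ?expR_ge0.
  apply: (@le_trans _ _ (Num.truncn q).+2%:R).
    by rewrite ler_nat; exact: (@size_first_sets _ _ _ (Num.truncn q).+1).
  by rewrite -!natr1; have := truncn_le q; rewrite q0; lra.
by exists (F phi).
Qed.

(** * Parameters and the final bound *)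

(* [G] is at most [259 t / e^2] and [n / r.+1] at least [n / (3 t)]; the hypothesis on [e]
   leaves room for [2 t G <= k <= n / (2 r.+1)]. *)
Lemma exists_parameters (R : realType) (n : nat) (t e : R) :
  1 <= t -> 0 < e -> e <= 1 / 2 -> e ^+ 2 * n%:R = 80 ^+ 2 * t ^+ 3 ->
  exists r p G k : nat, [/\ (0 < p)%N, (0 < G)%N & (0 < k)%N] /\
    [/\ 2 * t <= r.+1%:R, 2 * t * G%:R <= k%:R, 2 * k%:R <= n%:R / r.+1%:R :> R,
        2 * p.+1%:R <= e * G%:R & 64 * (4 * t) <= e ^+ 2 * G%:R].
Proof.
move=> t1 e0 e12 en.
have t0 : 0 < t by lra.
have te1 : 1 <= t / e by rewrite ler_pdivlMr//; lra.
have te2 : 1 <= t / e ^+ 2.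
  by rewrite ler_pdivlMr ?exprn_gt0// mul1r (le_trans _ t1)// exprn_ile1//; lra.
(* From p+1 > 128 t/e and e G >= 2(p+1) follows e^2 G >= 256 t; [k] is the largest integer with 2k
   <= n/(r+1). *)
pose r := Num.truncn (2 * t); pose p := Num.truncn (128 * (t / e)).
pose G := (Num.truncn (2 * p.+1%:R / e)).+1.
pose k := Num.truncn (n%:R / (2 * r.+1%:R) : R).
have /andP[r1 r2] : r%:R <= 2 * t < r.+1%:R by apply: truncn_itv; lra.
have /andP[p1 p2] : p%:R <= 128 * (t / e) < p.+1%:R by apply: truncn_itv; lra.
have Pe0 : 0 <= 2 * p.+1%:R / e by rewrite !mulr_ge0// invr_ge0 ltW.
have /andP[] := truncn_itv Pe0; rewrite -/G => G1 G2.
have kn0 : 0 <= n%:R / (2 * r.+1%:R) :> R by rewrite divr_ge0.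
have /andP[] := truncn_itv kn0; rewrite -/k => k1 k2.
have r3 : r.+1%:R <= 3 * t by rewrite -natr1; lra.
have r0 : 0 < r.+1%:R :> R by rewrite ltr0n.
have p3 : p.+1%:R <= 129 * (t / e) by rewrite -natr1; lra.
have G3 : G%:R <= 259 * (t / e ^+ 2).
  have : 2 * p.+1%:R / e <= 258 * (t / e ^+ 2).
    rewrite ler_pdivrMr// (_ : _ * e = 258 * (t / e)); last by field; lra.
    by lra.
  by rewrite /G -natr1; lra.
have n0 : 100 * t <= n%:R.
  have h1 : e ^+ 2 * n%:R <= 1 / 4 * n%:R.
    by rewrite ler_wpM2r//; have := mulr_ge0 (ltW e0) (ltW e0); nra.
  have h2 : t <= t ^+ 3 by apply: ler_eXnr.
  by lra.
(* The constant 80 gives n/(10t) = 640 t^2/e^2 >= 2tG, and k >= n/(6t) - 1 >= n/(10t) since n >=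
   100t. *)
have Gk : 2 * t * G%:R <= k%:R.
  have h1 : 2 * t * G%:R <= 1 / 10 * (n%:R / t).
    have -> : n%:R = 80 ^+ 2 * t ^+ 3 / e ^+ 2 by rewrite -en mulrC mulKf// expf_neq0 ?gt_eqF.
    rewrite (_ : 1 / 10 * _ = 2 * t * (320 * (t / e ^+ 2))); last first.
      by field; apply/andP; split; lra.
    by rewrite ler_wpM2l//; lra.
  have h2 : 1 / 6 * (n%:R / t) <= n%:R / (2 * r.+1%:R).
    rewrite (_ : 1 / 6 * _ = n%:R / (6 * t)); last by field; lra.
    by rewrite ler_wpM2l// lef_pV2 ?posrE ?mulr_gt0//; lra.
  have h3 : 100 <= n%:R / t by rewrite ler_pdivlMr.
  move: k2; rewrite -natr1; move: (n%:R / (2 * _)) h2 => y h2; lra.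
have p0 : (0 < p)%N by rewrite truncn_gt0; lra.
have G2' : 2 * p.+1%:R <= e * G%:R by rewrite -ler_pdivrMl// [leLHS]mulrC ltW.
exists r, p, G, k; split; split => //.
- by rewrite -(ltr_nat R); apply: lt_le_trans Gk; rewrite !mulr_gt0// ltr0n.
- exact: ltW.
- rewrite (_ : n%:R / _ = 2 * (n%:R / (2 * r.+1%:R))); last by field; lra.
  by rewrite ler_pM2l.
- have : 128 * t <= e * p.+1%:R by rewrite -ler_pdivrMl// [leLHS]mulrC -mulrA ltW.
  have : e * (2 * p.+1%:R) <= e * (e * G%:R) by rewrite ler_pM2l.
  by lra.
Qed.

(** For a = 2^t, a <= e^t gives e^(-4t) <= a^(-4), and 2a(a + 2) <= a^4 as a >= 2. *)
Lemma powR2_failure_le (R : realType) (t : R) :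
  1 <= t -> (2 `^ t + 2) * (2 * expR (- (4 * t))) <= 1 / 2 `^ t.
Proof.
move=> t1.
have a2 : 2 <= 2 `^ t.
  by rewrite -[leLHS]powRr1//; apply: ler_powR => //; rewrite ler1n.
have aE : 2 `^ t <= expR t.
  rewrite /powR pnatr_eq0 /= ler_expR ler_piMr//; first by lra.
  by have := le_ln1Dx (_ : -1 < (1 : R)); rewrite -natr1; apply; lra.
move: (2 `^ t) a2 aE => a a2 aE.
rewrite expRN expRM_natl ler_pdivlMr; last by lra.
have E4 : a ^+ 4 <= expR t ^+ 4 by apply: lerXn2r; rewrite ?nnegrE ?expR_ge0//; lra.
have a4 : (a + 2) * 2 * a <= a ^+ 4.
  rewrite exprSr; apply: ler_wpM2r; first by lra.
  have : 0 <= (a - 2) * (a * (a + 2)) by rewrite !mulr_ge0//; lra.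
  by lra.
rewrite mulrA mulrAC ler_pdivrMr ?exprn_gt0 ?expR_gt0// mul1r.
exact: le_trans E4.
Qed.

Theorem theorem2 (R : realType) (beta : R) (hbeta0 : 0 < beta)
    (hbeta1 : beta < 1 / 2) :
  exists (c1 c2 : R) (n0 : nat), 0 < c1 /\ 0 < c2 /\
  forall (n : nat) (N : finType) (eps : R),
    (n0 <= n)%N -> #|N| = n ->
    1 / n%:R `^ (1 / 3 - beta) <= eps ->
  forall (d : measure_display) (T : measurableType d) (P : probability T R)
    (A : nat -> T -> query_alg R N),
    random_output A ->
    query_complexity_lt eps A (2 `^ (c1 * n%:R `^ (beta / 2))) ->
  exists (k : nat) (F : {set N} -> R),
    approx_coverage eps F /\
    ((1 - 1 / 2 `^ (c2 * n%:R `^ (beta / 2)))%:E <=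
      P [set w : T |
          ratio_at_most F k (2 / n%:R `^ (beta / 2)) (run F (A k w))])%E.
Proof.
(* This [n0] ensures n^(1/8) >= 160, which absorbs the factor 80 in e <= 1/2 and in e <= eps. *)
exists 1, 1, (Num.truncn (160 ^+ 8 : R)).+1; do 2![split => //].
move=> n N eps hn cN heps d T P A hA; rewrite mul1r => hq.
set t := n%:R `^ (beta / 2) in hq *.
have n8 : 160 ^+ 8 <= n%:R :> R.
  by rewrite -(ler_nat R) in hn; apply: le_trans (ltW (truncnS_gt _)) hn.
have n1 : 1 <= n%:R :> R by apply: le_trans n8; rewrite exprn_ege1// ler1n.
have n0 : 0 < n%:R :> R by lra.
have nD (x y : R) : n%:R `^ (x + y) = n%:R `^ x * n%:R `^ y.
  by rewrite powRD // (gt_eqF n0) implybT.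
have m160 : 160 <= n%:R `^ (1 / 8) :> R.
  apply: le_trans (_ : (160 ^+ 8) `^ (1 / 8) <= _).
    by rewrite -powR_mulrn// -powRrM mulrC divfK ?pnatr_eq0// powRr1.
  by apply: ge0_ler_powR => //; rewrite nnegrE ?exprn_ge0.
have t1 : 1 <= t by rewrite -[leLHS](powRr0 (n%:R : R)); apply: ler_powR => //; lra.
(* The exponent makes e^2 n = 80^2 t^3. It is below -1/8 as beta < 1/2, and adding 1/8 keeps it
   below beta - 1/3. *)
pose e : R := 80 * n%:R `^ (3 * beta / 4 - 1 / 2).
have e0 : 0 < e by rewrite mulr_gt0// powR_gt0.
have e12 : e <= 1 / 2.
  have : n%:R `^ (3 * beta / 4 - 1 / 2) <= n%:R `^ (- (1 / 8)).
    by apply: ler_powR => //; lra.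
  have : n%:R `^ (- (1 / 8)) <= 1 / 160 :> R.
    by rewrite powRN -div1r ler_pM2l// lef_pV2// posrE; lra.
  by rewrite /e; lra.
have e_eps : e <= eps.
  apply: le_trans heps; rewrite div1r -powRN.
  apply: le_trans (_ : n%:R `^ (3 * beta / 4 - 1 / 2) * n%:R `^ (1 / 8) <= _).
    by rewrite /e mulrC ler_pM2l ?powR_gt0//; lra.
  by rewrite -nD; apply: ler_powR => //; lra.
have en : e ^+ 2 * n%:R = 80 ^+ 2 * t ^+ 3.
  rewrite /e exprMn -(mulrA (80 ^+ 2)); congr (_ * _).
  rewrite -!powR_mulrn ?powR_ge0// -!powRrM -[X in _ * X = _](powRr1 (ltW n0)) -nD.
  by congr (_ `^ _); field.
have [r [p [G [k [[p0 G0 k0] [tr tG kN hp htau]]]]]] := exists_parameters t1 e0 e12 en.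
rewrite -cN in kN.
have [F [aF hF]] :=
  hidden_set_hard P e0 e12 e_eps t1 k0 p0 G0 tr tG kN hp htau hA hq (powR_ge0 _ _).
exists k, F; split=> //; apply: le_trans hF.
by rewrite lee_fin lerB// powR2_failure_le.
Qed.
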